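(* For each charging station density $K$, let $\lambda(K)$ and $N(K)$ denote the demand and supply at equilibrium, i.e. the values of $\lambda$ and $N$ at the optimum of the platform's profit-maximization problem $$\max_{\lambda,N}\ \lambda\big(c_v(\lambda)-\alpha(t_r+t_p)-\beta(2t_d+t_w)\big)-N\,w(N)-KC,$$ with the total number of chargers fixed at $M_0$ (each station having $M_0/K$ chargers). Assume that $\lambda(K)$ and $N(K)$ first increase and then decrease with respect to $K$, and that they have a unique maximum at $K^*_\lambda$ and $K^*_N$, respectively. Then for any pickup time model following the square root law $t_p = \phi/\sqrt{N_i/A}$ and any supply model such that $N\mapsto N\,w(N)$ is convex, we always have $$K^*_N<K^*_\lambda.$$
   Context: Exogenous positive constants: $\tau$ (fraction of EVs needing charging per unit time), $\lambda_0$ (number of potential private vehicle owners), $N_0$ (number of potential couriers), $M_0$ (total number of public chargers), $A$ (city area), $t_c$ (mean charging time), $C$ (per-time wage of the coordinator at each station), $\phi,\theta$ (model parameters), and values of time $\alpha>\beta>0$. The variables $\lambda$ (arrival rate of valet charging customers), $N$ (number of couriers) and $K$ (number of charging stations, ''density'') are treated as positive real numbers. Demand model: $\lambda=\tau\lambda_0F_v(c_v)$, where $F_v$ is a decreasing function of the generalized cost $c_v$; $c_v(\lambda)$ is the inverse demand function. Supply model: $N=N_0F_c(w)$, where $F_c$ is a strictly increasing function of the average courier wage $w$; $w(N)$ is the inverse supply function. The service price is $p_v=c_v(\lambda)-\alpha(t_r+t_p)-\beta(2t_d+t_w)$. Times: - delivery time $t_d=\theta\sqrt{A/K}$; - pickup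 time $t_p=\phi/\sqrt{N_i/A}$, where the number of idle couriers $N_i>0$ satisfies $N_i=N-2\lambda t_p-2\lambda t_d$; when this equation has two positive roots $N_i$ for given $(\lambda,N)$, the platform's optimum is taken over both resulting market outcomes (the larger root gives the higher profit, so $t_p$ is the one given by the larger root); - response time $t_r=\dfrac{1}{2\lambda}\cdot\dfrac{\rho_d^{\sqrt{2N+2}}}{1-\rho_d}$ with $\rho_d=2\lambda(t_p+t_d)/N<1$; - waiting time $t_w=\dfrac{K}{\lambda}\cdot\dfrac{\rho_c^{\sqrt{2M_0/K+2}}}{1-\rho_c}$ with $\rho_c=\lambda t_c/M_0<1$. Feasibility requires $\lambda<\min\{M_0/t_c,\ N/(2(t_p+t_d))\}$.
   Formalization: The formal theorem additionally assumes that λ(K) is differentiable at its maximizer K*_λ; without this, λ(K) can have a corner at its peak and then K*_N = K*_λ is possible. *)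

(* Defs.v *)
From Stdlib Require Import Reals.
From Coquelicot Require Import Coquelicot.
Open Scope R_scope.

(* Costs and wages range over arbitrary domains [cost_dom], [wage_dom], so that
   e.g. nonnegative or capped wages are covered. *)
Record market := Market {
  tau : R;            (* fraction of EVs needing charging per unit time *)
  lam0 : R;           (* potential private vehicle owners *)
  N0 : R;             (* potential couriers *)
  M0 : R;             (* total number of public chargers *)
  area : R;
  tc : R;             (* mean charging time *)
  coord_cost : R;     (* cost of the coordinator of one station, per unit time *)
  phi : R;
  theta : R;
  alpha : R;
  beta : R;
  cost_dom : R -> Prop;
  Fv : R -> R;
  cv : R -> R;
  wage_dom : R -> Prop;
  Fc : R -> R;
  wage : R -> R
}.

Definition constants_ok (m : market) : Prop :=
  0 < tau m /\ 0 < lam0 m /\ 0 < N0 m /\ 0 < M0 m /\ 0 < area m /\ 0 < tc m /\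
  0 < coord_cost m /\ 0 < phi m /\ 0 < theta m /\ 0 < beta m /\
  beta m < alpha m.

Definition demand_range (m : market) (lam : R) : Prop :=
  0 < lam /\ exists c, cost_dom m c /\ lam = tau m * lam0 m * Fv m c.

Definition supply_range (m : market) (N : R) : Prop :=
  0 < N /\ exists w, wage_dom m w /\ N = N0 m * Fc m w.

(* Strictness of the monotonicity of [Fv] is not required: [cv] is then any
   choice of a cost generating the given demand. *)
Definition demand_model (m : market) : Prop :=
  (forall c1 c2, cost_dom m c1 -> cost_dom m c2 -> c1 <= c2 ->
     Fv m c2 <= Fv m c1) /\
  (forall lam, demand_range m lam ->
     cost_dom m (cv m lam) /\ lam = tau m * lam0 m * Fv m (cv m lam)).

Definition supply_model (m : market) : Prop :=
  (forall w1 w2, wage_dom m w1 -> wage_dom m w2 -> w1 < w2 ->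
     Fc m w1 < Fc m w2) /\
  (forall N, supply_range m N ->
     wage_dom m (wage m N) /\ N = N0 m * Fc m (wage m N)).

Definition convex_on (D : R -> Prop) (f : R -> R) : Prop :=
  forall x y t, D x -> D y -> 0 <= t <= 1 ->
    D (t * x + (1 - t) * y) /\
    f (t * x + (1 - t) * y) <= t * f x + (1 - t) * f y.

Definition t_delivery (m : market) (K : R) : R :=
  theta m * sqrt (area m / K).

Definition t_pickup (m : market) (Ni : R) : R :=
  phi m / sqrt (Ni / area m).

Definition rho_d (m : market) (K lam N Ni : R) : R :=
  2 * lam * (t_pickup m Ni + t_delivery m K) / N.

Definition t_response (m : market) (K lam N Ni : R) : R :=
  1 / (2 * lam) *
  (Rpower (rho_d m K lam N Ni) (sqrt (2 * N + 2)) / (1 - rho_d m K lam N Ni)).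

Definition rho_c (m : market) (lam : R) : R := lam * tc m / M0 m.

Definition t_waiting (m : market) (K lam : R) : R :=
  K / lam *
  (Rpower (rho_c m lam) (sqrt (2 * M0 m / K + 2)) / (1 - rho_c m lam)).

(* The number of idle couriers [Ni] is kept as a separate variable because the
   balance equation can have two positive roots for given [lam] and [N]; each
   root is a market outcome available to the platform. *)
Definition feasible (m : market) (K lam N Ni : R) : Prop :=
  demand_range m lam /\ supply_range m N /\ 0 < Ni /\
  Ni = N - 2 * lam * t_pickup m Ni - 2 * lam * t_delivery m K /\
  lam < Rmin (M0 m / tc m) (N / (2 * (t_pickup m Ni + t_delivery m K))).

Definition profit (m : market) (K lam N Ni : R) : R :=
  lam * (cv m lam
         - alpha m * (t_response m K lam N Ni + t_pickup m Ni)
         - beta m * (2 * t_delivery m K + t_waiting m K lam))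
  - N * wage m N - K * coord_cost m.

Definition is_optimum (m : market) (K lam N : R) : Prop :=
  exists Ni, feasible m K lam N Ni /\
    forall lam' N' Ni', feasible m K lam' N' Ni' ->
      profit m K lam' N' Ni' <= profit m K lam N Ni.

Definition rises_then_falls (f : R -> R) : Prop :=
  exists Kp, 0 < Kp /\
    (forall K1 K2, 0 < K1 -> K1 <= K2 -> K2 <= Kp -> f K1 <= f K2) /\
    (forall K1 K2, Kp <= K1 -> K1 <= K2 -> f K2 <= f K1).

Definition unique_max_at (f : R -> R) (Kstar : R) : Prop :=
  0 < Kstar /\ forall K, 0 < K -> K <> Kstar -> f K < f Kstar.

(* Main.v *)
Require Import Defs.
From Stdlib Require Import Reals Ranalysis5 Lra Psatz.
From Coquelicot Require Import Coquelicot.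
Open Scope R_scope.

(** The argument is a monotone comparative statics one, made by exchanging
    optima.  Let [n] be the number of idle couriers, [d = 2 lam t_d] the
    couriers engaged in deliveries and [p = 2 lam phi sqrt A].  The balance
    equation reads [N = n + p / sqrt n + d], and since [rho_d = 1 - n / N],
    the delay terms of the profit that involve [N] reduce to
    [- alpha / 2 * (queue_delay N n + (N - n))], up to a term that depends only
    on [K] and [lam] ([profit_eq]).

    The larger the demand and the delivery load, the fewer couriers of a given
    fleet are idle, and the more an additional courier saves, on two counts.
    Idle couriers respond more strongly to the fleet: by [fleet_increment], [N]
    grows by
    [1 - p / sqrt x / (sqrt y * (sqrt x + sqrt y))] per courier becoming idle
    as [n] goes from [x] to [y], which is smaller for smaller [x] and [y]
    ([idle_gain_lt]).  And [queue_delay] is convex in [n], with a marginal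
    delay that decreases with [N] when the busy couriers [N - n] are fixed
    ([queue_delay_saving_antitone]).  Hence the cost of the couriers has
    strictly decreasing differences ([fleet_exchange]).  Exchanging the fleets
    of two optima, together with their wage bills, which cancel, then shows
    that the optimal fleet is monotone in demand and delivery load
    ([optimal_fleet_le]).

    For [K > Klam] both [lam] and [t_d] are smaller than at [Klam], so
    [N K <= N Klam], which excludes [KN > Klam].  If [KN = Klam], then [lam]
    is stationary there whereas [t_d] has a negative derivative; for some
    [k < Klam] the rise of the delivery load outweighs the drop of the demand
    ([delivery_load_dominates]), so [N k >= N Klam], contradicting the
    uniqueness of the maximizer of [N]. *)

(** * Queueing delay of the couriers *)

(** Twice [lam * t_response], as a function of the fleet size [N] and of the
    number [n] of idle couriers alone. *)
Definition queue_delay (N n : R) : R :=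
  Rpower (1 - n / N) (sqrt (2 * N + 2)) / (n / N).

(** Minus the derivative of [queue_delay N] at an [n] such that
    [1 - n / N = r]. *)
Definition marginal_delay (N r : R) : R :=
  sqrt (2 * N + 2) / N * (Rpower r (sqrt (2 * N + 2) - 1) / (1 - r)) +
  / N * (Rpower r (sqrt (2 * N + 2)) / ((1 - r) * (1 - r))).

Lemma idle_share_bounds (N n : R) : 0 < n < N -> 0 < n / N < 1.
Proof.
  intros [H1 H2]. split.
  - apply Rdiv_lt_0_compat; lra.
  - apply Rmult_lt_reg_r with N; [lra|]. unfold Rdiv.
    rewrite Rmult_assoc, Rinv_l; lra.
Qed.

Lemma is_derive_queue_delay (N n : R) : 0 < n < N ->
  is_derive (queue_delay N) n (- marginal_delay N (1 - n / N)).
Proof.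
  intros Hn. pose proof (idle_share_bounds N n Hn) as Hs.
  unfold queue_delay, marginal_delay.
  set (s := sqrt (2 * N + 2)).
  replace (Rpower (1 - n / N) (s - 1))
    with (Rpower (1 - n / N) s / (1 - n / N)).
  2:{ replace (s - 1) with (s + - (1)) by ring.
      rewrite Rpower_plus, Rpower_Ropp, Rpower_1; [reflexivity|lra]. }
  unfold Rpower. auto_derive.
  - unfold Rdiv in Hs. repeat split; lra.
  - unfold Rdiv. fold (1 - n * / N). field. repeat split; try lra.
Qed.

Lemma Rpower_exponent_antitone (r s t : R) :
  0 < r <= 1 -> s <= t -> Rpower r t <= Rpower r s.
Proof.
  intros Hr Hst. unfold Rpower.
  assert (Hl : ln r <= 0) by (rewrite <- ln_1; apply ln_le; lra).
  destruct (Req_dec (t * ln r) (s * ln r)) as [E|E]; [rewrite E; lra|].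
  apply Rlt_le, exp_increasing. nra.
Qed.

Lemma Rdiv_le_compat (x y c d : R) :
  0 <= x <= y -> 0 < c <= d -> x / d <= y / c.
Proof.
  intros Hxy Hcd. unfold Rdiv. apply Rmult_le_compat; try lra.
  - apply Rlt_le, Rinv_0_lt_compat; lra.
  - apply Rinv_le_contravar; lra.
Qed.

Lemma queue_delay_antitone (N n n' : R) :
  0 < n -> n <= n' -> n' < N -> queue_delay N n' <= queue_delay N n.
Proof.
  intros H1 H2 H3. unfold queue_delay.
  pose proof (idle_share_bounds N n ltac:(lra)).
  pose proof (idle_share_bounds N n' ltac:(lra)).
  assert (n / N <= n' / N) by
    (apply Rmult_le_compat_r; [apply Rlt_le, Rinv_0_lt_compat|]; lra).
  apply Rdiv_le_compat; [split|lra].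
  - apply Rlt_le, exp_pos.
  - apply Rle_Rpower_l; [apply sqrt_pos|lra].
Qed.

Lemma sqrt_fleet_gt_1 (N : R) : 0 < N -> 1 < sqrt (2 * N + 2).
Proof. intros HN. rewrite <- sqrt_1 at 1. apply sqrt_lt_1; lra. Qed.

Lemma marginal_delay_antitone (P Q r r' : R) :
  0 < P -> P <= Q -> 0 < r' -> r' <= r -> r < 1 ->
  marginal_delay Q r' <= marginal_delay P r.
Proof.
  intros HP HPQ Hr' Hrr Hr. unfold marginal_delay.
  pose proof (sqrt_fleet_gt_1 P HP) as HsP.
  assert (HsPQ : sqrt (2 * P + 2) <= sqrt (2 * Q + 2))
    by (apply sqrt_le_1; lra).
  assert (EP : sqrt (2 * P + 2) * sqrt (2 * P + 2) = 2 * P + 2)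
    by (apply sqrt_sqrt; lra).
  assert (EQ : sqrt (2 * Q + 2) * sqrt (2 * Q + 2) = 2 * Q + 2)
    by (apply sqrt_sqrt; lra).
  set (s := sqrt (2 * P + 2)) in *. set (t := sqrt (2 * Q + 2)) in *.
  assert (Hpow : forall c, 0 <= c <= 1 ->
                   Rpower r' (t - c) <= Rpower r (s - c)).
  { intros c Hc. apply Rle_trans with (Rpower r (t - c)).
    - apply Rle_Rpower_l; lra.
    - apply Rpower_exponent_antitone; lra. }
  assert (Hst : t / Q <= s / P).
  { (* As [P = (s^2 - 2) / 2] and [Q = (t^2 - 2) / 2], this amounts to
       [0 <= (t - s) * (s * t + 2)]. *)
    apply Rmult_le_reg_r with (P * Q); [nra|].
    replace (t / Q * (P * Q)) with (t * P) by (field; lra).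
    replace (s / P * (P * Q)) with (s * Q) by (field; lra).
    assert (0 <= (t - s) * (s * t + 2)) by (apply Rmult_le_pos; nra). nra. }
  apply Rplus_le_compat; apply Rmult_le_compat.
  - apply Rlt_le, Rdiv_lt_0_compat; lra.
  - apply Rlt_le, Rdiv_lt_0_compat; [apply exp_pos|lra].
  - exact Hst.
  - apply Rdiv_le_compat; [split; [apply Rlt_le, exp_pos|]|lra].
    apply Hpow; lra.
  - apply Rlt_le, Rinv_0_lt_compat; lra.
  - apply Rlt_le, Rdiv_lt_0_compat; [apply exp_pos|nra].
  - apply Rinv_le_contravar; lra.
  - apply Rdiv_le_compat; [split; [apply Rlt_le, exp_pos|]|nra].
    rewrite <- (Rminus_0_r s), <- (Rminus_0_r t). apply Hpow; lra.
Qed.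

(** Enlarging the fleet from [P] to [Q] while the idle couriers gain
    [D >= Q - P] saves more delay when fewer couriers are idle: the marginal
    delay is larger at [(P, e)] than at [(Q, e + D)], where both the share of
    busy couriers and their number are at most the same. *)
Lemma queue_delay_saving_antitone (P Q D x u : R) :
  0 < P -> P <= Q -> Q - P <= D -> 0 < x -> x < u -> u < P -> u + D < Q ->
  queue_delay P u - queue_delay Q (u + D) <=
  queue_delay P x - queue_delay Q (x + D).
Proof.
  intros HP HPQ HD Hx Hxu HuP HuQ.
  set (f := fun e => queue_delay P e - queue_delay Q (e + D)).
  set (df := fun e => marginal_delay Q (1 - (e + D) / Q)
                      - marginal_delay P (1 - e / P)).
  assert (Hf : forall e, x <= e <= u -> is_derive f e (df e)).
  { intros e He. unfold f, df.
    replace (_ - _) with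
      (minus (- marginal_delay P (1 - e / P))
             (scal 1 (- marginal_delay Q (1 - (e + D) / Q))))
      by (unfold minus, plus, opp, scal; simpl; unfold mult; simpl; ring).
    apply (is_derive_minus (queue_delay P) (fun e => queue_delay Q (e + D))).
    - apply is_derive_queue_delay; lra.
    - apply (is_derive_comp (queue_delay Q) (fun e => e + D)).
      + apply is_derive_queue_delay; lra.
      + auto_derive; [exact I|ring]. }
  destruct (MVT_gen f x u df) as [c [Hc E]].
  - intros e He. rewrite Rmin_left, Rmax_right in He by lra. apply Hf; lra.
  - intros e He. rewrite Rmin_left, Rmax_right in He by lra.
    apply continuity_pt_filterlim, (ex_derive_continuous f).
    exists (df e). now apply Hf.
  - rewrite Rmin_left, Rmax_right in Hc by lra.
    assert (Hdf : df c <= 0).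
    { unfold df.
      pose proof (idle_share_bounds P c ltac:(lra)).
      pose proof (idle_share_bounds Q (c + D) ltac:(lra)).
      assert (c / P <= (c + D) / Q).
      { apply Rmult_le_reg_r with (P * Q); [nra|].
        replace (c / P * (P * Q)) with (c * Q) by (field; lra).
        replace ((c + D) / Q * (P * Q)) with ((c + D) * P) by (field; lra).
        nra. }
      pose proof (marginal_delay_antitone P Q (1 - c / P) (1 - (c + D) / Q)
                    HP HPQ). lra. }
    change (f u <= f x). nra.
Qed.

(** * Idle couriers and the balance equation *)

(** Fleet size for which [n] couriers are idle, when [p / sqrt n] are engaged
    in pickups ([2 lam t_p]) and [d] in deliveries ([2 lam t_d]). *)
Definition fleet (p d n : R) : R := n + p / sqrt n + d.

Lemma fleet_root (p d x N : R) :
  0 < p -> 0 < d -> 0 < x -> fleet p d x <= N ->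
  exists z, x <= z < N /\ fleet p d z = N.
Proof.
  intros Hp Hd Hx HN.
  assert (Hgt : forall z, 0 < z -> z + d < fleet p d z).
  { intros z Hz. unfold fleet.
    assert (0 < p / sqrt z) by (apply Rdiv_lt_0_compat, sqrt_lt_R0; lra).
    lra. }
  pose proof (Hgt x Hx).
  destruct (Req_dec (fleet p d x) N) as [E|E]; [exists x; split; [lra|exact E]|].
  destruct (IVT_interv (fun z => fleet p d z - N) x N) as [z [Hz E']].
  - intros z Hz. apply continuity_pt_filterlim.
    apply (ex_derive_continuous (fun z => fleet p d z - N)).
    unfold fleet. auto_derive.
    assert (0 < sqrt z) by (apply sqrt_lt_R0; lra). repeat split; lra.
  - lra.
  - lra.
  - pose proof (Hgt N); lra.
  - exists z. pose proof (Hgt z ltac:(lra)). split; lra.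
Qed.

(** Growth of the fleet when idle couriers go from [x] to [x + D], with the
    mean growth per idle courier factored out. *)
Lemma fleet_increment (p d x D : R) : 0 < x -> 0 <= D ->
  fleet p d (x + D) - fleet p d x =
  D * (1 - p / sqrt x / (sqrt (x + D) * (sqrt x + sqrt (x + D)))).
Proof.
  intros Hx HD. unfold fleet.
  assert (Ha : 0 < sqrt x) by (apply sqrt_lt_R0; lra).
  assert (Hb : 0 < sqrt (x + D)) by (apply sqrt_lt_R0; lra).
  assert (Ea : sqrt x * sqrt x = x) by (apply sqrt_sqrt; lra).
  assert (Eb : sqrt (x + D) * sqrt (x + D) = x + D) by (apply sqrt_sqrt; lra).
  set (a := sqrt x) in *. set (b := sqrt (x + D)) in *.
  replace D with (b * b - a * a) by lra.
  replace x with (a * a) by lra. field. lra.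
Qed.

(** With more idle couriers and no more couriers engaged in pickups, the same
    fleet increment leaves fewer additional couriers idle.  Here [y] may be
    either root of its balance equation. *)
Lemma idle_gain_lt (p1 p2 d1 d2 P Q u y x v : R) :
  0 < p1 -> 0 < p2 -> P < Q -> 0 < x -> x < u -> x < v ->
  p1 / sqrt u <= p2 / sqrt x ->
  fleet p1 d1 u = P -> fleet p1 d1 y = Q ->
  fleet p2 d2 x = P -> fleet p2 d2 v = Q ->
  y - u < v - x.
Proof.
  intros Hp1 Hp2 HPQ Hx Hxu Hxv Hp E1P E1Q E2P E2Q.
  destruct (Rlt_le_dec (y - u) (v - x)) as [|Hle]; [assumption|exfalso].
  pose proof (fleet_increment p1 d1 u (y - u) ltac:(lra) ltac:(lra)) as F1.
  pose proof (fleet_increment p2 d2 x (v - x) ltac:(lra) ltac:(lra)) as F2.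
  replace (u + (y - u)) with y in F1 by ring.
  replace (x + (v - x)) with v in F2 by ring.
  rewrite E1P, E1Q in F1. rewrite E2P, E2Q in F2.
  assert (Hsx : 0 < sqrt x) by (apply sqrt_lt_R0; lra).
  assert (Hsxu : sqrt x < sqrt u) by (apply sqrt_lt_1; lra).
  assert (Hsxv : sqrt x < sqrt v) by (apply sqrt_lt_1; lra).
  assert (Hsvy : sqrt v < sqrt y) by (apply sqrt_lt_1; lra).
  set (q1 := _ / (sqrt y * _)) in F1. set (q2 := _ / (sqrt v * _)) in F2.
  assert (q1 < q2).
  { unfold q1, q2. apply Rle_lt_trans with
      (p2 / sqrt x / (sqrt y * (sqrt u + sqrt y))).
    - apply Rmult_le_compat_r; [apply Rlt_le, Rinv_0_lt_compat; nra|lra].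
    - apply Rmult_lt_compat_l; [apply Rdiv_lt_0_compat; lra|].
      apply Rinv_lt_contravar; [repeat apply Rmult_lt_0_compat; lra|nra]. }
  assert (0 < 1 - q2) by nra.
  nra.
Qed.

(** * The exchange inequality *)

(** Enlarging the fleet from [P] to [Q] saves more of the cost
    [queue_delay N n + (N - n)] in the second environment, which has the larger
    delivery load and a demand not too much smaller, if at all.  The idle
    couriers [y] and [x] are given, while [u] and [v] are suitable roots of the
    balance equation once the two fleets have been exchanged. *)
Lemma fleet_exchange (p1 p2 d1 d2 P Q x y : R) :
  0 < p1 -> 0 < p2 -> 0 < d1 -> d1 < d2 -> P < Q -> 0 < x -> 0 < y ->
  fleet p2 d2 x = P -> fleet p1 d1 y = Q ->
  p1 ^ 2 * x <= p2 ^ 2 * (x + (d2 - d1)) ->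
  exists u v, 0 < u /\ 0 < v /\ fleet p1 d1 u = P /\ fleet p2 d2 v = Q /\
    queue_delay P u - queue_delay Q y + (y - u) <
    queue_delay P x - queue_delay Q v + (v - x).
Proof.
  intros Hp1 Hp2 Hd1 Hd HPQ Hx Hy EP EQ Hp.
  assert (Hlt : forall p d n, 0 < p -> 0 < d -> 0 < n -> n < fleet p d n).
  { intros p d n ? ? ?. unfold fleet.
    assert (0 < p / sqrt n) by (apply Rdiv_lt_0_compat, sqrt_lt_R0; lra).
    lra. }
  assert (Hsx : 0 < sqrt x) by (apply sqrt_lt_R0; lra).
  (* The extra delivery load [d2 - d1] is spared in the first environment:
     leaving these couriers idle there does not exceed the fleet [P]. *)
  set (x' := x + (d2 - d1)).
  assert (Hx' : x < x') by (unfold x'; lra).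
  assert (Hsx' : 0 < sqrt x') by (apply sqrt_lt_R0; lra).
  assert (Hpx : p1 / sqrt x' <= p2 / sqrt x).
  { apply Rmult_le_reg_r with (sqrt x * sqrt x'); [nra|].
    replace (p1 / sqrt x' * _) with (p1 * sqrt x) by (field; lra).
    replace (p2 / sqrt x * _) with (p2 * sqrt x') by (field; lra).
    apply Rsqr_incr_0; try nra.
    unfold Rsqr.
    replace (p1 * sqrt x * (p1 * sqrt x)) with (p1 ^ 2 * (sqrt x * sqrt x)) by ring.
    replace (p2 * sqrt x' * (p2 * sqrt x')) with (p2 ^ 2 * (sqrt x' * sqrt x')) by ring.
    rewrite !sqrt_sqrt; unfold x'; lra. }
  destruct (fleet_root p1 d1 x' P) as [u [Hu Eu]]; try assumption.
  { lra. }
  { unfold fleet in EP |- *. unfold x' in *. lra. }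
  destruct (fleet_root p2 d2 x Q) as [v [Hv Ev]]; try lra.
  assert (Hxu : x < u) by lra.
  assert (Hxv : x < v).
  { destruct (Req_dec x v) as [E|E]; [subst v|]; lra. }
  assert (Hgain : y - u < v - x).
  { apply (idle_gain_lt p1 p2 d1 d2 P Q); try assumption.
    apply Rle_trans with (p1 / sqrt x'); [|exact Hpx].
    apply Rdiv_le_compat; [lra|]. split; [lra|]. apply sqrt_le_1; lra. }
  exists u, v. repeat split; try lra.
  pose proof (Hlt p1 d1 y Hp1 Hd1 Hy).
  assert (HPQv : Q - P <= v - x).
  { rewrite <- Ev, <- EP. unfold fleet.
    assert (p2 / sqrt v <= p2 / sqrt x).
    { apply Rdiv_le_compat; [lra|]. split; [lra|]. apply sqrt_le_1; lra. }
    lra. }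
  (* [y] may be the smaller root of its balance equation, in which case the
     gain [y - u] can be less than [Q - P] or even negative. *)
  set (D := Rmax (y - u) (Q - P)).
  assert (HD1 : y - u <= D) by apply Rmax_l.
  assert (HD2 : Q - P <= D) by apply Rmax_r.
  assert (HDv : D <= v - x) by (apply Rmax_lub; lra).
  assert (HDQ : u + D < Q) by (unfold D; apply Rmax_case; lra).
  pose proof (queue_delay_saving_antitone P Q D x u) as S.
  pose proof (queue_delay_antitone Q y (u + D)).
  pose proof (queue_delay_antitone Q (x + D) v).
  lra.
Qed.

(** * Optimal fleet sizes *)

(** [2 lam t_p sqrt n], which does not depend on the idle couriers [n]. *)
Definition pickup_load (m : market) (lam : R) : R :=
  2 * lam * (phi m * sqrt (area m)).

(** Number of couriers engaged in deliveries. *)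
Definition delivery_load (m : market) (K lam : R) : R :=
  2 * lam * t_delivery m K.

Lemma t_pickup_eq (m : market) (n : R) : constants_ok m -> 0 < n ->
  t_pickup m n = phi m * sqrt (area m) / sqrt n.
Proof.
  intros Hc Hn. unfold constants_ok in Hc.
  unfold t_pickup. rewrite sqrt_div_alt by lra.
  assert (0 < sqrt n) by (apply sqrt_lt_R0; lra).
  assert (0 < sqrt (area m)) by (apply sqrt_lt_R0; lra).
  field. lra.
Qed.

Lemma t_delivery_pos (m : market) (K : R) :
  constants_ok m -> 0 < K -> 0 < t_delivery m K.
Proof.
  intros Hc HK. unfold constants_ok in Hc. unfold t_delivery.
  apply Rmult_lt_0_compat; [lra|].
  apply sqrt_lt_R0, Rdiv_lt_0_compat; lra.
Qed.

Lemma t_delivery_lt (m : market) (K K' : R) :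
  constants_ok m -> 0 < K -> K < K' -> t_delivery m K' < t_delivery m K.
Proof.
  intros Hc HK HK'. unfold constants_ok in Hc. unfold t_delivery.
  apply Rmult_lt_compat_l; [lra|]. apply sqrt_lt_1.
  - apply Rlt_le, Rdiv_lt_0_compat; lra.
  - apply Rlt_le, Rdiv_lt_0_compat; lra.
  - apply Rmult_lt_compat_l; [lra|]. apply Rinv_lt_contravar; nra.
Qed.

Lemma feasible_balance (m : market) (K lam N n : R) : constants_ok m ->
  0 < n -> (n = N - 2 * lam * t_pickup m n - 2 * lam * t_delivery m K <->
            fleet (pickup_load m lam) (delivery_load m K lam) n = N).
Proof.
  intros Hc Hn. rewrite t_pickup_eq by assumption.
  unfold fleet, pickup_load, delivery_load.
  unfold Rdiv. split; intros; lra.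
Qed.

Lemma feasible_swap (m : market) (K lam N n K' lam' N' n' z : R) :
  constants_ok m -> 0 < K -> feasible m K lam N n -> feasible m K' lam' N' n' ->
  0 < z -> fleet (pickup_load m lam) (delivery_load m K lam) z = N' ->
  feasible m K lam N' z.
Proof.
  intros Hc HK [Hd [_ [_ [_ Hcap]]]] [_ [Hs _]] Hz E.
  apply feasible_balance in E; try assumption.
  repeat split; try assumption; try apply Hd; try apply Hs.
  assert (0 < t_pickup m z).
  { rewrite t_pickup_eq by assumption. unfold constants_ok in Hc.
    apply Rdiv_lt_0_compat; [apply Rmult_lt_0_compat|]; try lra;
      apply sqrt_lt_R0; lra. }
  pose proof (t_delivery_pos m K Hc HK).
  apply Rmin_glb_lt.
  - eapply Rlt_le_trans; [exact Hcap|apply Rmin_l].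
  - apply Rmult_lt_reg_r with (2 * (t_pickup m z + t_delivery m K)); [lra|].
    unfold Rdiv. rewrite Rmult_assoc, Rinv_l by lra. lra.
Qed.

(** For given [K] and [lam], the profit depends on the fleet only through the
    courier costs. *)
Lemma profit_eq (m : market) (K lam N n : R) : feasible m K lam N n ->
  profit m K lam N n =
  lam * (cv m lam - beta m * (2 * t_delivery m K + t_waiting m K lam))
  - K * coord_cost m + alpha m * lam * t_delivery m K - N * wage m N
  - alpha m / 2 * (queue_delay N n + (N - n)).
Proof.
  intros [[Hl _] [[HN _] [Hn [E _]]]].
  assert (Hr : rho_d m K lam N n = 1 - n / N).
  { unfold rho_d.
    replace (2 * lam * (t_pickup m n + t_delivery m K)) with (N - n) by lra.
    field. lra. }
  unfold profit, t_response, queue_delay. rewrite Hr.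
  replace (1 - (1 - n / N)) with (n / N) by ring.
  set (T := Rpower _ _ / _).
  replace (N - n) with (2 * lam * (t_pickup m n + t_delivery m K)) by lra.
  field. lra.
Qed.

(** The optimal fleet is monotone in the delivery load, provided that the
    demand does not fall too much.
    The wage bill is exchanged along with the fleet, so it drops out of the
    comparison of the two optima. *)
Lemma optimal_fleet_le (m : market) (K1 K2 l1 l2 N1 N2 : R) :
  constants_ok m -> 0 < K1 -> 0 < K2 ->
  is_optimum m K1 l1 N1 -> is_optimum m K2 l2 N2 ->
  delivery_load m K1 l1 < delivery_load m K2 l2 ->
  (forall x, 0 < x < N2 ->
     l1 ^ 2 * x <=
     l2 ^ 2 * (x + (delivery_load m K2 l2 - delivery_load m K1 l1))) ->
  N1 <= N2.
Proof.
  intros Hc HK1 HK2 [y [F1 O1]] [x [F2 O2]] Hd Hl.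
  destruct (Rle_lt_dec N1 N2) as [|HN]; [assumption|exfalso].
  pose proof (t_delivery_pos m K1 Hc HK1) as Ht1.
  pose proof (t_delivery_pos m K2 Hc HK2) as Ht2.
  assert (Hc' := Hc). unfold constants_ok in Hc'.
  assert (Hk : 0 < phi m * sqrt (area m))
    by (apply Rmult_lt_0_compat; [|apply sqrt_lt_R0]; lra).
  pose proof F1 as [[Hl1 _] [_ [Hy [E1 _]]]].
  pose proof F2 as [[Hl2 _] [_ [Hx [E2 _]]]].
  assert (Hp1 : 0 < pickup_load m l1) by (unfold pickup_load; nra).
  assert (Hp2 : 0 < pickup_load m l2) by (unfold pickup_load; nra).
  assert (Hd1 : 0 < delivery_load m K1 l1) by (unfold delivery_load; nra).
  apply feasible_balance in E1; try assumption.
  apply feasible_balance in E2; try assumption.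
  assert (Hx2 : x < N2).
  { rewrite <- E2. unfold fleet.
    assert (0 < pickup_load m l2 / sqrt x)
      by (apply Rdiv_lt_0_compat, sqrt_lt_R0; lra). lra. }
  destruct (fleet_exchange _ _ _ _ N2 N1 x y Hp1 Hp2 Hd1 Hd HN Hx Hy E2 E1)
    as [u [v [Hu [Hv [Eu [Ev HE]]]]]].
  { specialize (Hl x ltac:(lra)). unfold pickup_load.
    set (k := phi m * sqrt (area m)) in *. set (D := _ - _) in *.
    replace ((2 * l1 * k) ^ 2 * x) with (4 * k ^ 2 * (l1 ^ 2 * x)) by ring.
    replace ((2 * l2 * k) ^ 2 * (x + D))
      with (4 * k ^ 2 * (l2 ^ 2 * (x + D))) by ring.
    apply Rmult_le_compat_l; [nra|exact Hl]. }
  pose proof (feasible_swap _ _ _ _ _ _ _ _ _ _ Hc HK1 F1 F2 Hu Eu) as G1.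
  pose proof (feasible_swap _ _ _ _ _ _ _ _ _ _ Hc HK2 F2 F1 Hv Ev) as G2.
  specialize (O1 _ _ _ G1). specialize (O2 _ _ _ G2).
  rewrite (profit_eq _ _ _ _ _ F1), (profit_eq _ _ _ _ _ G1) in O1.
  rewrite (profit_eq _ _ _ _ _ F2), (profit_eq _ _ _ _ _ G2) in O2.
  assert (0 < alpha m) by lra.
  nra.
Qed.

(** * Comparison of the two maximizers *)

Lemma is_derive_local_max (f : R -> R) (x : R) : 0 < x ->
  (forall y, 0 < y -> f y <= f x) -> ex_derive f x -> is_derive f x 0.
Proof.
  intros Hx Hmax Hf. apply ex_derive_Reals_0 in Hf.
  pose proof (deriv_maximum f 0 (x + 1) x Hf Hx ltac:(lra)
                (fun y H0 _ => Hmax y H0)) as E.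
  apply is_derive_Reals. now apply derive_pt_eq_1 in E.
Qed.

Lemma negative_derivative_left (f : R -> R) (x l : R) :
  0 < x -> is_derive f x l -> l < 0 -> exists y, 0 < y < x /\ f x < f y.
Proof.
  intros Hx Hf Hl. apply is_derive_Reals in Hf.
  destruct (Hf (- l) ltac:(lra)) as [del Hdel].
  pose proof (cond_pos del) as Hpos.
  set (h := Rmin (del / 2) (x / 2)).
  assert (Hh : 0 < h) by (apply Rmin_glb_lt; lra).
  assert (h <= del / 2) by apply Rmin_l.
  assert (h <= x / 2) by apply Rmin_r.
  specialize (Hdel (- h) ltac:(lra)).
  rewrite Rabs_Ropp, (Rabs_right h) in Hdel by lra.
  specialize (Hdel ltac:(lra)). apply Rabs_def2 in Hdel.
  exists (x + - h). split; [lra|].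
  assert (Hq : (f (x + - h) - f x) / - h < 0) by lra.
  assert (E : f (x + - h) - f x = (f (x + - h) - f x) / - h * - h)
    by (field; lra).
  nra.
Qed.

Lemma is_derive_t_delivery (m : market) (K : R) : constants_ok m -> 0 < K ->
  exists l, l < 0 /\ is_derive (t_delivery m) K l.
Proof.
  intros Hc HK. unfold constants_ok in Hc.
  assert (HAK : 0 < area m / K) by (apply Rdiv_lt_0_compat; lra).
  assert (Hs : 0 < sqrt (area m / K)) by (apply sqrt_lt_R0; lra).
  exists (- (theta m * area m / (2 * K ^ 2 * sqrt (area m / K)))). split.
  - apply Ropp_lt_gt_0_contravar, Rdiv_lt_0_compat;
      repeat apply Rmult_lt_0_compat; try lra; apply pow_lt; lra.
  - unfold t_delivery. auto_derive.
    + unfold Rdiv in HAK. lra.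
    + unfold Rdiv. field. unfold Rdiv in Hs. lra.
Qed.

(** Since [lam] is stationary at its maximizer while the delivery time is
    strictly decreasing there, slightly fewer stations raise the delivery load
    to first order and lower the demand by a smaller order only. *)
Lemma delivery_load_dominates (m : market) (lam : R -> R) (K N : R) :
  constants_ok m -> 0 < K -> 0 < lam K -> 0 < N -> is_derive lam K 0 ->
  exists k, 0 < k < K /\
    lam K ^ 2 * N <
    lam k ^ 2 *
      (N + (delivery_load m k (lam k) - delivery_load m K (lam K))).
Proof.
  intros Hc HK Hl HN Hd.
  destruct (is_derive_t_delivery m K Hc HK) as [l [Hl' Ht]].
  set (d0 := delivery_load m K (lam K)).
  set (F := fun k => lam k ^ 2 * (N + (delivery_load m k (lam k) - d0))).
  destruct (negative_derivative_left F K (2 * lam K ^ 3 * l)) as [k [Hk HF]].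
  - exact HK.
  - unfold F, delivery_load. auto_derive.
    + repeat split; eexists; eassumption.
    + replace (Derive (fun x => lam x) K) with 0
        by (symmetry; now apply is_derive_unique).
      replace (Derive (fun x => t_delivery m x) K) with l
        by (symmetry; now apply is_derive_unique).
      unfold d0, delivery_load. ring.
  - assert (0 < lam K ^ 3) by (apply pow_lt; lra). nra.
  - exists k. split; [exact Hk|]. unfold F in HF. fold d0.
    fold d0 in HF. lra.
Qed.

Theorem proposition2 (m : market)
  (hconst : constants_ok m)
  (hdemand : demand_model m)
  (hsupply : supply_model m)
  (hconvex : convex_on (supply_range m) (fun N => N * wage m N))
  (lam N : R -> R)
  (hopt : forall K, 0 < K -> is_optimum m K (lam K) (N K))
  (hlam : rises_then_falls lam) (hN : rises_then_falls N)
  (Klam KN : R)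
  (hKlam : unique_max_at lam Klam) (hKN : unique_max_at N KN)
  (hdiff : ex_derive lam Klam) :
  KN < Klam.
Proof.
  destruct hKlam as [HK Hmax]. destruct hKN as [HKN HmaxN].
  assert (Hpos : forall K, 0 < K -> 0 < lam K /\ 0 < N K).
  { intros K H0. destruct (hopt K H0) as [n [[[? _] [[? _] _]] _]]. auto. }
  destruct (Rtotal_order KN Klam) as [|[E|Hgt]]; [assumption|exfalso|exfalso].
  - (* Slightly fewer stations would call for at least as large a fleet. *)
    subst KN.
    assert (Hd : is_derive lam Klam 0).
    { apply is_derive_local_max; [exact HK| |exact hdiff]. intros K H0.
      destruct (Req_dec K Klam) as [->|H]; [lra|]. now apply Rlt_le, Hmax. }
    destruct (Hpos Klam HK) as [Hl HNp].
    destruct (delivery_load_dominates m lam Klam (N Klam) hconst HK Hl HNp Hd)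
      as [k [Hk Hload]].
    destruct (Hpos k ltac:(lra)) as [Hlk _].
    pose proof (Hmax k ltac:(lra) ltac:(lra)) as Hlt.
    pose proof (HmaxN k ltac:(lra) ltac:(lra)) as HltN.
    set (D := _ - _) in Hload.
    assert (Hsq : lam k ^ 2 < lam Klam ^ 2) by (simpl; nra).
    assert (0 < lam k ^ 2) by (simpl; nra).
    assert (HD : 0 < D) by nra.
    apply (Rlt_irrefl (N k)), Rlt_le_trans with (N Klam); [exact HltN|].
    apply (optimal_fleet_le m Klam k (lam Klam) (lam k));
      try assumption; try apply hopt; try lra.
    + unfold D in HD. lra.
    + intros x Hx. fold D. nra.
  - (* Beyond [Klam] both the demand and the delivery time are smaller. *)
    pose proof (Hmax KN HKN ltac:(lra)) as Hlt.
    pose proof (HmaxN Klam HK ltac:(lra)) as HltN.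
    destruct (Hpos KN HKN) as [Hl _].
    pose proof (t_delivery_lt m Klam KN hconst HK Hgt).
    pose proof (t_delivery_pos m KN hconst HKN).
    assert (Hload : delivery_load m KN (lam KN)
                    < delivery_load m Klam (lam Klam))
      by (unfold delivery_load; nra).
    apply (Rlt_irrefl (N KN)), Rle_lt_trans with (N Klam); [|exact HltN].
    apply (optimal_fleet_le m KN Klam (lam KN) (lam Klam));
      try assumption; try now apply hopt.
    intros x Hx. apply Rmult_le_compat; try lra.
    + apply pow_le; lra.
    + apply pow_incr; lra.
Qed.
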